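(* Let $r \in U(60)$ with $r \equiv 3 \pmod 4$, and let $k \in \{0,1,\ldots,59\}$. Then the subsequence $(\mathcal{F}_{10,k+rj})_{j=0}^\infty$ is a reverse complete Fibonacci subsequence. That is: (i) for all $j \in \mathbb{Z}$, $\mathcal{F}_{10,k+r(j+1)} + \mathcal{F}_{10,k+rj} \equiv \mathcal{F}_{10,k+r(j-1)} \pmod{10}$; (ii) its diagram is of Type 3; and (iii) there exists $N_{k,r} \in \{0,1,\ldots,59\}$ such that $\mathcal{F}_{10,k+rj} = \mathcal{F}_{10,N_{k,r}-j}$ for all integers $j \geq 0$.
   Context: The Fibonacci numbers are $F_0=0$, $F_1=1$, $F_n=F_{n-1}+F_{n-2}$, extended to all $n\in\mathbb{Z}$ by the same recurrence. For $n \in \mathbb{Z}$, $\mathcal{F}_{10,n} \in \{0,1,\ldots,9\}$ is the least nonnegative residue of $F_n$ modulo $10$; the sequence $(\mathcal{F}_{10,n})$ is periodic with period $60$. $U(60)=\{1\le r\le 59 : \gcd(r,60)=1\}$ is the multiplicative group of units modulo $60$. The diagram of $(\mathcal{F}_{10,k+rj})_{j=0}^\infty$ is obtained by placing 60 points, indexed by residues modulo $60$, on a circle and joining successive points indexed by $k+rj \bmod 60$; it is of Type 3 when $\gcd(r,60)=1$ (so all 60 points are vertices). The subsequence is reverse quasi-Fibonacci if (i) holds, and a reverse complete Fibonacci subsequence if it is reverse quasi-Fibonacci with a Type 3 diagram, in which case it coincides with $(\mathcal{F}_{10,n})_{n=N_{k,r}}^{-\infty}$ (the sequence run backwards from index $N_{k,r}$)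 for some $N_{k,r} \in \{0,\ldots,59\}$; all of this is included in the claim. *)

(* Defs.v *)
From HB Require Import structures.
From mathcomp Require Import all_boot all_order all_algebra.

Set Implicit Arguments.
Unset Strict Implicit.
Unset Printing Implicit Defensive.

Import Order.TTheory GRing.Theory Num.Theory.
Local Open Scope ring_scope.

Fixpoint fib (n : nat) : int :=
  match n with
  | 0%N => 0
  | 1%N => 1
  | (n''.+1 as n').+1 => fib n' + fib n''
  end.

(* [fib_neg n] is F_(-n): the recurrence solved for its smallest index,
   F_(-(n+2)) = F_(-n) - F_(-(n+1)), started from F_0 = 0 and F_(-1) = 1. *)
Fixpoint fib_neg (n : nat) : int :=
  match n with
  | 0%N => 0
  | 1%N => 1
  | (n''.+1 as n').+1 => fib_neg n'' - fib_neg n'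
  end.

Definition fibz (n : int) : int :=
  match n with
  | Posz m => fib m
  | Negz m => fib_neg m.+1
  end.

Lemma fibz_rec (n : int) : fibz n = fibz (n - 1) + fibz (n - 2).
Proof.
have fibE m : fib m.+2 = fib m.+1 + fib m by [].
have fibnE m : fib_neg m.+2 = fib_neg m - fib_neg m.+1 by [].
have fibzN m : fibz (- m%:Z) = fib_neg m by case: m.
case: n => [[|[|n]]|n] //.
  have -> : n.+2%:Z - 1 = n.+1%:Z by rewrite -[n.+2]addn1 PoszD addrK.
  have -> : n.+2%:Z - 2 = n%:Z by rewrite -[n.+2]addn2 PoszD addrK.
  by rewrite /fibz fibE.
rewrite NegzE.
have -> : - n.+1%:Z - 1 = - n.+2%:Z by rewrite -opprD -PoszD addn1.
have -> : - n.+1%:Z - 2 = - n.+3%:Z by rewrite -opprD -PoszD addn2.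
by rewrite !fibzN [fib_neg n.+3]fibnE addrC subrK.
Qed.

Definition fib10 (n : int) : int := (fibz n %% 10)%Z.

Definition in_U60 (r : nat) : bool := [&& 1 <= r, r <= 59 & coprime r 60]%N.

Definition reverse_quasi_Fibonacci (k r : nat) : Prop :=
  forall j : int,
    (fib10 (k%:Z + r%:Z * (j + 1)) + fib10 (k%:Z + r%:Z * j)
       = fib10 (k%:Z + r%:Z * (j - 1)) %[mod 10])%Z.

(* The diagram joins successive points of this sequence of residues mod 60. *)
Definition diagram_point (k r j : nat) : nat := ((k + r * j) %% 60)%N.

(* The second conjunct follows from the first; it spells out that every one of
   the 60 points of the circle is a vertex of the diagram. *)
Definition diagram_type3 (k r : nat) : Prop :=
  coprime r 60 /\
  forall v : nat, (v < 60)%N -> exists j : nat, diagram_point k r j = v.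

Definition reverse_complete_Fibonacci (k r : nat) : Prop :=
  reverse_quasi_Fibonacci k r /\ diagram_type3 k r.

(* Main.v *)
(** Modulo 10 the Fibonacci numbers have period 60, which gives
    F_(n+r) + F_n = F_(n-r) (mod 10) for the units r = 3 (mod 4): this is
    F_(n+r) - F_(n-r) = L_r F_n (r odd) with L_r = -1 (mod 10).  Hence
    j |-> F_(k-rj) satisfies the Fibonacci recurrence modulo 10, and so it
    agrees with j |-> F_(N+j) as soon as N matches its terms at j = 0 and
    j = 1; such an N is found by a finite search over one period. *)
Require Import Defs.
From HB Require Import structures.
From mathcomp Require Import all_boot all_order all_algebra.
From mathcomp Require Import zify ring.

Set Implicit Arguments.
Unset Strict Implicit.
Unset Printing Implicit Defensive.

Import Order.TTheory GRing.Theory Num.Theory.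
Local Open Scope ring_scope.

(** Two consecutive multiples of [m] force the next term and the previous one to be multiples of
    [m], since the recurrence can be solved for either end; so the induction carries a pair of terms
    in both directions from 0. *)
Lemma dvdz_fib_rec (m : int) (c : int -> int) :
    (forall n, m %| c (n + 2) - (c (n + 1) + c n))%Z ->
    (m %| c 0)%Z -> (m %| c 1)%Z ->
  forall n, (m %| c n)%Z.
Proof.
move=> rec c0 c1 n.
suff /andP[] : (m %| c n)%Z && (m %| c (n + 1))%Z by [].
elim/int_rec: n => [|n /andP[IH0 IH1]|n /andP[IH0 IH1]]; first exact/andP.
- have -> : n.+1%:Z = n%:Z + 1 by lia.
  rewrite IH1 -addrA -(subrK (c (n%:Z + 1) + c n%:Z) (c (n%:Z + (1 + 1)))).
  apply: rpredD; [exact: rec | exact: rpredD].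
- have En1 : - n.+1%:Z + 1 = - n%:Z by lia.
  have En2 : - n.+1%:Z + 2 = - n%:Z + 1 by lia.
  move: (rec (- n.+1%:Z)); rewrite En1 En2 IH0 andbT => rec_n.
  have -> : c (- n.+1%:Z) = c (- n%:Z + 1) - c (- n%:Z)
      - (c (- n%:Z + 1) - (c (- n%:Z) + c (- n.+1%:Z))) by ring.
  by apply: rpredB => //; apply: rpredB.
Qed.

(** The recurrence is linear, so the difference [a - b] satisfies it modulo [m] and vanishes there
    at 0 and 1. *)
Lemma eqmodz_fib_rec (m : int) (a b : int -> int) :
    (forall n, a (n + 2) = a (n + 1) + a n %[mod m])%Z ->
    (forall n, b (n + 2) = b (n + 1) + b n %[mod m])%Z ->
    (a 0 = b 0 %[mod m])%Z -> (a 1 = b 1 %[mod m])%Z ->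
  forall n, (a n = b n %[mod m])%Z.
Proof.
move=> reca recb /eqP ab0 /eqP ab1 n; apply/eqP; rewrite eqz_mod_dvd.
rewrite !eqz_mod_dvd in ab0 ab1.
apply: (@dvdz_fib_rec m (fun n => a n - b n)) => // {}n.
have /eqP := reca n; have /eqP := recb n; rewrite !eqz_mod_dvd => Hb Ha.
have -> : a (n + 2) - b (n + 2) - (a (n + 1) - b (n + 1) + (a n - b n))
  = a (n + 2) - (a (n + 1) + a n) - (b (n + 2) - (b (n + 1) + b n)) by ring.
exact: rpredB.
Qed.

(** The residues of F_0, ..., F_59 modulo 10, which [fib10_eqmod] justifies. *)
Definition fib10_period : seq nat :=
  [:: 0; 1; 1; 2; 3; 5; 8; 3; 1; 4; 5; 9; 4; 3; 7; 0; 7; 7; 4; 1;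
      5; 6; 1; 7; 8; 5; 3; 8; 1; 9; 0; 9; 9; 8; 7; 5; 2; 7; 9; 6;
      5; 1; 6; 7; 3; 0; 3; 3; 6; 9; 5; 4; 9; 3; 2; 5; 7; 2; 9; 1]%N.

Definition fib10_nat (n : nat) : nat := nth 0%N fib10_period (n %% 60).

Lemma all_iotaP (P : pred nat) (n : nat) :
  all P (iota 0 n) -> forall i, (i < n)%N -> P i.
Proof. by move/allP => PP i lt_in; apply: PP; rewrite mem_iota. Qed.

Lemma modz60E (n : int) : exists2 m : nat, (m < 60)%N & (n %% 60)%Z = m.
Proof. by exists `|(n %% 60)%Z|%N; lia. Qed.

Lemma fib10_nat_rec (m : nat) : (m < 60)%N ->
  fib10_nat (m + 2) = ((fib10_nat (m + 1) + fib10_nat m) %% 10)%N.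
Proof.
move=> lt_m; apply/eqP; move: m lt_m; apply: all_iotaP.
by vm_compute.
Qed.

(** The table, repeated with period 60 over all integers, satisfies the Fibonacci recurrence modulo
    10 and starts with 0, 1. This gives the periodicity of [fib10] and reduces later claims to
    finite checks. *)
Lemma fib10_eqmod (n : int) (m : nat) :
  (n = m%:Z %[mod 60])%Z -> fib10 n = fib10_nat m.
Proof.
pose b (i : int) : int := fib10_nat `|(i %% 60)%Z|%N.
have bE (i : int) (p : nat) : (i = p%:Z %[mod 60])%Z -> b i = fib10_nat p.
  by rewrite /b => ->; rewrite modz_nat absz_nat /fib10_nat modn_mod.
move=> /bE <-.
(* All table entries are below 10, so the equality to prove is a congruence modulo 10. *)
have -> : b n = (b n %% 10)%Z.
  have [p lt_p Ep] := modz60E n.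
  rewrite (bE n p) ?Ep ?modz_mod; last by lia.
  rewrite modz_nat modn_small //; move: p lt_p {Ep}; apply: all_iotaP.
  by vm_compute.
apply: (@eqmodz_fib_rec 10 fibz b) => // i.
- by rewrite fibz_rec; congr ((fibz _ + fibz _) %% _)%Z; ring.
- have [p lt_p Ep] := modz60E i.
  rewrite (bE i p) ?(bE (i + 1) (p + 1)%N) ?(bE (i + 2) (p + 2)%N); try by lia.
  by rewrite fib10_nat_rec // -PoszD modz_nat modn_mod -modz_nat.
Qed.

(** Checked for all pairs [r], [n] by computation; [60 - r] stands for [-r] modulo 60, which keeps
    the index natural. *)
Lemma fib10_nat_step (r n : nat) : in_U60 r -> (r = 3 %[mod 4])%N -> (n < 60)%N ->
  ((fib10_nat (n + r) + fib10_nat n) %% 10 = fib10_nat (n + (60 - r)))%N.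
Proof.
move=> hr hr4 lt_n; apply/eqP.
have lt_r : (r < 60)%N by case/and3P: hr.
have r_ok : in_U60 r && (r %% 4 == 3)%N by rewrite hr hr4.
have: all (fun r => in_U60 r && (r %% 4 == 3)%N ==>
    all (fun n => (fib10_nat (n + r) + fib10_nat n) %% 10
                  == fib10_nat (n + (60 - r)))%N (iota 0 60)) (iota 0 60).
  by vm_compute.
by move=> /all_iotaP/(_ _ lt_r)/implyP/(_ r_ok)/all_iotaP; apply.
Qed.

Lemma fib10_nat_start (r k : nat) : in_U60 r -> (r = 3 %[mod 4])%N -> (k < 60)%N ->
  exists2 N, (N < 60)%N &
    fib10_nat k = fib10_nat N /\ fib10_nat (k + (60 - r)) = fib10_nat (N + 1).
Proof.
move=> hr hr4 lt_k.
have lt_r : (r < 60)%N by case/and3P: hr.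
have r_ok : in_U60 r && (r %% 4 == 3)%N by rewrite hr hr4.
have: all (fun r => in_U60 r && (r %% 4 == 3)%N ==>
    all (fun k => has (fun N => (fib10_nat k == fib10_nat N) &&
        (fib10_nat (k + (60 - r)) == fib10_nat (N + 1)))%N (iota 0 60))
      (iota 0 60)) (iota 0 60).
  by vm_compute.
move=> /all_iotaP/(_ _ lt_r)/implyP/(_ r_ok)/all_iotaP/(_ _ lt_k).
case/hasP => N; rewrite mem_iota => /= lt_N /andP[/eqP E0 /eqP E1].
by exists N.
Qed.

Lemma fib10_step (r : nat) (n : int) : in_U60 r -> (r = 3 %[mod 4])%N ->
  ((fib10 (n + r%:Z) + fib10 n) %% 10)%Z = fib10 (n - r%:Z).
Proof.
move=> hr hr4; have [_ le_r _] := and3P hr.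
have [m lt_m Em] := modz60E n.
rewrite (@fib10_eqmod n m) ?(@fib10_eqmod (n + r%:Z) (m + r)); try by lia.
rewrite (@fib10_eqmod (n - r%:Z) (m + (60 - r))); last by lia.
by rewrite -PoszD modz_nat fib10_nat_step.
Qed.

Lemma fib10_mod10 (n : int) : (fib10 n %% 10)%Z = fib10 n.
Proof. exact: modz_mod. Qed.

Lemma diagram_type3_coprime (k r : nat) : (0 < r)%N -> coprime r 60 ->
  diagram_type3 k r.
Proof.
move=> r_gt0 co_r; split=> // v lt_v.
case: (egcdnP 60 r_gt0) => u w; rewrite (eqP co_r) => Euw _.
(* By Bezout [u] inverts [r] modulo 60, and [59 * k] stands for [-k], so [r] times this witness is
   [v - k] modulo 60. *)
exists (u * (v + 59 * k))%N.
rewrite /diagram_point mulnA (mulnC r) Euw.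
by rewrite -[RHS](modn_small lt_v) -(modnMDl (w * (v + 59 * k) + k) v); congr modn; ring.
Qed.

Theorem theorem5p11 (r k : nat)
    (hr : in_U60 r) (hr4 : (r = 3 %[mod 4])%N) (hk : (k < 60)%N) :
  reverse_complete_Fibonacci k r /\
  exists N : nat, (N < 60)%N /\
    forall j : nat, fib10 (k%:Z + r%:Z * j%:Z) = fib10 (N%:Z - j%:Z).
Proof.
have [r_gt0 le_r co_r] := and3P hr.
split; first split.
- move=> j; rewrite fib10_mod10 -(_ : k%:Z + r%:Z * j - r%:Z = k%:Z + r%:Z * (j - 1)).
    by rewrite -fib10_step //; congr ((fib10 _ + fib10 _) %% _)%Z; ring.
  by ring.
- exact: diagram_type3_coprime.
have [N lt_N [E0 E1]] := fib10_nat_start hr hr4 hk.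
exists N; split=> // j.
pose a (i : int) := fib10 (k%:Z - r%:Z * i).
pose b (i : int) := fib10 (N%:Z + i).
(* Both sequences satisfy the recurrence on all integers, so they may be compared at [-j], where the
   indices are [k + r * j] and [N - j]. *)
have: (a (- j%:Z) = b (- j%:Z) %[mod 10])%Z.
  apply: eqmodz_fib_rec => [i|i||].
  - rewrite fib10_mod10 [a (i + 1) + _]addrC /a.
    rewrite -(_ : k%:Z - r%:Z * (i + 1) - r%:Z = k%:Z - r%:Z * (i + 2)).
      by rewrite -fib10_step //; congr ((fib10 _ + fib10 _) %% _)%Z; ring.
    by ring.
  - rewrite /b /fib10 modzDm modz_mod fibz_rec.
    by congr ((fibz _ + fibz _) %% _)%Z; ring.
  - by rewrite /a /b (@fib10_eqmod _ k) ?(@fib10_eqmod _ N) ?E0 //; lia.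
  - rewrite /a /b (@fib10_eqmod _ (k + (60 - r))); last by lia.
    by rewrite (@fib10_eqmod (_ + 1) (N + 1)) ?E1 //; lia.
by rewrite !fib10_mod10 /a /b mulrN opprK.
Qed.
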